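(* Let $a,k,n$ be integers such that $0\leq a\leq k$. If $n\geq 1$, then $$\mathcal{C}^{(n)}_{a\bar\Lambda_0+(k-a)\bar\Lambda_n}(z)=\sum_{i=0}^a\sum_{j=0}^{k-a}(zq)^{i+j}\,\mathcal{D}^{(n+1)}_{i\bar\Lambda_0+(a-i)\bar\Lambda_1+(k-a-j)\bar\Lambda_n+j\bar\Lambda_{n+1}}(zq).$$ If $n\geq 0$, then $$\mathcal{D}^{(n+1)}_{a\bar\Lambda_0+(k-a)\bar\Lambda_{n+1}}(z)=\mathcal{C}^{(n)}_{a\bar\Lambda_0+(k-a)\bar\Lambda_n}(zq).$$
   Context: An $m$-coloured partition $\lambda$ is a finite multiset of parts, each part being a positive integer $i$ (its size) together with a colour $c\in\{1,\dots,m\}$. Let $f_i^{(c)}$ be the multiplicity of parts of size $i\geq 1$ and colour $c$, $|\lambda|=\sum_{i,c}if_i^{(c)}$ and $l(\lambda)=\sum_{i,c}f_i^{(c)}$. Type C. Let $n\geq 0$, $m=2n+1$ and $k_0,\dots,k_n$ nonnegative integers. Consider $m$-coloured partitions in which all parts with odd colour label are odd and all parts with even colour label are even. Put $f_{-1}^{(2c+1)}:=k_c$ for $0\leq c\leq n$ and $f_0^{(2c)}:=0$ for $1\leq c\leq n$. A path is a sequence $(p_1,\dots,p_m)=(f^{(1)}_{i_1},\dots,f^{(m)}_{i_m})$ with $i_c\geq -1$ and $i_c+c$ even for all $1\leq c\leq m$, and $|i_r-i_{r+1}|=1$ for $1\leq r<m$. $\mathscr{C}_{k_0,\dots,k_n}$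 is the set of such partitions for which $\sum_{r=1}^m p_r\leq k_0+\dots+k_n$ for all paths. Type D. Let $n\geq 1$, $m=2n-1$ and $k_0,\dots,k_n$ nonnegative integers. Consider $m$-coloured partitions in which all parts with even colour label are odd and all parts with odd colour label are even. Put $f_{-1}^{(2c)}:=k_c$ for $1\leq c\leq n-1$ and $f_0^{(2c-1)}:=k_0\delta_{c,1}+k_n\delta_{c,n}$ for $1\leq c\leq n$. A path is a sequence $(p_1,\dots,p_m)=(f^{(1)}_{i_1},\dots,f^{(m)}_{i_m})$ with $i_c\geq -1$ and $i_c+c$ odd for all $1\leq c\leq m$, and $|i_r-i_{r+1}|=1$ for $1\leq r<m$. $\mathscr{D}_{k_0,\dots,k_n}$ is the set of such partitions for which $\sum_{r=1}^m p_r\leq k_0+\dots+k_n$ for all paths. Generating functions (formal power series): $$\mathcal{C}^{(n)}_{k_0\bar\Lambda_0+\dots+k_n\bar\Lambda_n}(z)=\sum_{\lambda\in\mathscr{C}_{k_0,\dots,k_n}}z^{l(\lambda)}q^{|\lambda|},\qquad \mathcal{D}^{(n)}_{k_0\bar\Lambda_0+\dots+k_n\bar\Lambda_n}(z)=\sum_{\lambda\in\mathscr{D}_{k_0,\dots,k_n}}z^{l(\lambda)}q^{|\lambda|}.$$ The symbols $\bar\Lambda_i$ (scaled fundamental weights) are linearly independent and only serve to index the tuple $(k_0,\dots,k_n)$; coefficients of coinciding symbols are added (e.g. for $n=1$ in the first identity the coefficient of $\bar\Lambda_1$ is $k-i-j$; for $n=0$ in the second, $a\bar\Lambda_0+(k-a)\bar\Lambda_0=k\bar\Lambda_0$).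 *)

(* Defs.v *)
From HB Require Import structures.
From mathcomp Require Import all_boot all_order all_algebra.
From mathcomp Require Import finmap multiset.
From mathcomp Require Import boolp classical_sets functions cardinality.

Set Implicit Arguments.
Unset Strict Implicit.
Unset Printing Implicit Defensive.

Import Order.TTheory GRing.Theory Num.Theory.
Local Open Scope classical_set_scope.
Local Open Scope ring_scope.

(* A part is a pair (size, colour). *)
Definition parts := {mset (nat * nat)%type}%mset.

Definition coloured_partition (m : nat) (lam : parts) : Prop :=
  forall p, p \in lam -> (0 < p.1)%N /\ (0 < p.2 <= m)%N.

Definition psize (lam : parts) : nat :=
  (\sum_(p <- finsupp lam) p.1 * lam p)%N.

Definition plength (lam : parts) : nat :=
  (\sum_(p <- finsupp lam) lam p)%N.

(* k_0 Lambda_0 + ... + k_n Lambda_n is the finite function c |-> k_c; sums of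
   multiples of the Lambda_c then add the coefficients of coinciding symbols. *)
Definition weight (n : nat) := {ffun 'I_n.+1 -> nat}.

(* Only meaningful for c <= n. *)
Definition Lambda {n : nat} (c : nat) : weight n :=
  [ffun d : 'I_n.+1 => nat_of_bool (d == c :> nat)].

Definition wcoef (n : nat) (k : weight n) (c : nat) : nat := k (inord c).

Definition level (n : nat) (k : weight n) : nat := (\sum_c k c)%N.

(* The index sequence (i_1, ..., i_m) of a path; only the values of idx on
   1, ..., m are relevant.  The boolean ev prescribes the parity of i_c + c. *)
Definition path_indices (ev : bool) (m : nat) (idx : nat -> int) : Prop :=
  [/\ forall c, (0 < c <= m)%N -> -1 <= idx c,
      forall c, (0 < c <= m)%N -> (2 %| idx c + c%:Z)%Z = ev &
      forall r, (0 < r < m)%N -> `|idx r - idx r.+1| = 1].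

(* Extended frequencies f_i^(c) for i >= -1: Negz 0 is -1, and a colour
   c = 2d+1 gets f_{-1} = k_d = k_(c./2). The remaining values (i < -1, or
   i = -1 with c even) occur in no path. *)
Definition freqC (n : nat) (k : weight n) (lam : parts) (c : nat) (i : int)
    : nat :=
  match i with
  | Posz 0 => 0%N
  | Posz s => lam (s, c)
  | Negz 0 => if odd c then wcoef k c./2 else 0%N
  | Negz _ => 0%N
  end.

Definition partitions_C (n : nat) (k : weight n) : set parts :=
  [set lam |
    [/\ coloured_partition (2 * n + 1) lam,
        forall p, p \in lam -> odd p.1 = odd p.2 &
        forall idx, path_indices true (2 * n + 1) idx ->
          (\sum_(1 <= r < (2 * n + 1).+1) freqC k lam r (idx r)
             <= level k)%N]].

(* Extended frequencies for n >= 1: a colour c = 2d gets f_{-1} = k_d, and for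
   i = 0 the extreme colours 1 and 2n-1 (which coincide when n = 1) get k_0 and
   k_n respectively. *)
Definition freqD (n : nat) (k : weight n) (lam : parts) (c : nat) (i : int)
    : nat :=
  match i with
  | Posz 0 => (wcoef k 0 * (c == 1) + wcoef k n * (c == 2 * n - 1))%N
  | Posz s => lam (s, c)
  | Negz 0 => if odd c then 0%N else wcoef k c./2
  | Negz _ => 0%N
  end.

(* Only meaningful for n >= 1. *)
Definition partitions_D (n : nat) (k : weight n) : set parts :=
  [set lam |
    [/\ coloured_partition (2 * n - 1) lam,
        forall p, p \in lam -> odd p.1 = ~~ odd p.2 &
        forall idx, path_indices false (2 * n - 1) idx ->
          (\sum_(1 <= r < (2 * n - 1).+1) freqD k lam r (idx r)
             <= level k)%N]].

(* F l N is the coefficient of z^l q^N. The addition is the pointwise one of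
   functions. *)
Definition series := nat -> nat -> int.

Definition series_mul (F G : series) : series := fun l N =>
  \sum_(i < l.+1) \sum_(j < N.+1) F i j * G (l - i)%N (N - j)%N.

Definition series_monomial (s t : nat) : series := fun l N =>
  ((l == s) && (N == t))%:R.

(* F(z) |-> F(zq), i.e. z^l q^N |-> z^l q^(N + l). *)
Definition series_zq (F : series) : series := fun l N =>
  if (l <= N)%N then F l (N - l)%N else 0.

(* fset_set is only meaningful for finite sets, see finite_psize below. *)
Definition generating_series (S : set parts) : series := fun l N =>
  (#|` fset_set [set lam | [/\ S lam, plength lam = l & psize lam = N]]|)%:Z.

Lemma finite_psize (m N : nat) :
  finite_set [set lam | coloured_partition m lam /\ psize lam = N].
Proof.
pose h (lam : parts) :=
  [ffun u : 'I_N.+1 * 'I_m.+1 => inord (lam (u.1 : nat, u.2 : nat)) : 'I_N.+1].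
have bnd lam p : coloured_partition m lam -> psize lam = N -> p \in lam ->
    [/\ (p.1 < N.+1)%N, (p.2 < m.+1)%N & (lam p < N.+1)%N].
  move=> cl sl pl; have [p1 /andP[_ p2]] := cl _ pl.
  have le : (p.1 * lam p <= N)%N.
    by rewrite -sl /psize (big_fsetD1 p) ?msuppE//= leq_addr.
  have l0 : (0 < lam p)%N by rewrite -in_mset.
  by split=> //; rewrite ltnS; apply: leq_trans le;
    [rewrite leq_pmulr | rewrite leq_pmull].
set A := [set lam | _].
have hinj : {in A &, injective h}.
  move=> x y /set_mem[cx sx] /set_mem[cy sy] hxy; apply/msetP => p.
  have [/orP pxy|] := boolP ((p \in x) || (p \in y)); last first.
    by rewrite negb_or => /andP[/mset_eq0P -> /mset_eq0P ->].
  have [p1 p2] : (p.1 < N.+1)%N /\ (p.2 < m.+1)%N.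
    by case: pxy => pxy; have [] := bnd _ _ _ _ pxy.
  have lt z : coloured_partition m z -> psize z = N -> (z p < N.+1)%N.
    move=> cz sz; have [/bnd[]//|] := boolP (p \in z).
    by move/mset_eq0P => ->.
  have /ffunP/(_ (Ordinal p1, Ordinal p2)) := hxy.
  rewrite !ffunE /= -surjective_pairing => /(congr1 val) /=.
  by rewrite !inordK ?lt.
have fin : finite_set (h @` A) by exact: finite_finset.
by rewrite -(eq_finite_set (inj_card_eq hinj)).
Qed.

Definition series_C (n : nat) (k : weight n) : series :=
  generating_series (partitions_C k).

Definition series_D (n : nat) (k : weight n) : series :=
  generating_series (partitions_D k).

(* Main.v *)
(* Adding 1 to every size maps the type D paths to the type C paths. In the
   second identity this shift is a bijection: the path through f_0^(odd) and
   f_1^(even) already has weight k, so no part of size 1 occurs in type D. In the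
   first identity, paths through f_{-1}, f_0 and a single f_1 force the parts of
   size 1 of a type C partition to have colour 1 (i of them, i <= a) or 2n+1 (j of
   them, j <= k - a). Removing these i + j parts and shifting the others down by 1
   gives the partitions of type D with f_0^(1) = i, f_{-1}^(2) = a - i,
   f_{-1}^(2n) = k - a - j and f_0^(2n+1) = j. *)

Require Import Defs.
From mathcomp Require Import all_boot all_order all_algebra.
From mathcomp Require Import functions.
From mathcomp Require Import finmap multiset.
From mathcomp Require Import boolp classical_sets cardinality.
From mathcomp Require Import zify.
Import Order.TTheory GRing.Theory Num.Theory.
Local Open Scope ring_scope.

Set Implicit Arguments.
Unset Strict Implicit.
Unset Printing Implicit Defensive.

(** * Shifting all sizes by one *)

Lemma msetDE (K : choiceType) (A B : {mset K}%mset) (x : K) :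
  (A `+` B)%mset x = (A x + B x)%N.
Proof. by rewrite msetE2. Qed.

Definition raise (mu : parts) : parts :=
  seq_mset [seq (p.1.+1, p.2) | p <- enum_mset mu].

(** The filter keeps parts of size 1 from becoming parts of size 0. On coloured partitions [lower]
    undoes [raise], and [raise] undoes [lower] up to the parts of size 1. *)
Definition lower (lam : parts) : parts :=
  seq_mset [seq (p.1.-1, p.2) | p <- enum_mset lam & (1 < p.1)%N].

Lemma raise0E (mu : parts) c : raise mu (0%N, c) = 0%N.
Proof.
rewrite mset_seqE count_map; apply/eqP.
by rewrite -leqn0 leqNgt -has_count -all_predC; apply/allP.
Qed.

Lemma raiseSE (mu : parts) s c : raise mu (s.+1, c) = mu (s, c).
Proof.
rewrite mset_seqE count_map -count_mem_mset; apply: eq_count => -[s' c'] /=.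
by rewrite !xpair_eqE eqSS.
Qed.

Lemma lower0E (lam : parts) c : lower lam (0%N, c) = 0%N.
Proof.
rewrite mset_seqE count_map count_filter; apply/eqP.
rewrite -leqn0 leqNgt -has_count -all_predC; apply/allP => -[s' c'] _ /=.
by rewrite !xpair_eqE; case: s' => [|[|s']] //=; rewrite andbF.
Qed.

Lemma lowerSE (lam : parts) s c : lower lam (s.+1, c) = lam (s.+2, c).
Proof.
rewrite mset_seqE count_map count_filter -count_mem_mset.
by apply: eq_count => -[[|[|s']] c'] //=; rewrite !xpair_eqE ?eqSS ?andbT ?andbF.
Qed.

Lemma raise_inj : injective raise.
Proof.
by move=> x y xy; apply/msetP => -[s c]; rewrite -raiseSE xy raiseSE.
Qed.

(** * Length and size under union and shift *)

(** Listing parts with repetition, rather than over the support, turns unions into concatenations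
    and [raise] into a map. *)
Lemma plength_sum (lam : parts) : plength lam = (\sum_(p <- enum_mset lam) 1)%N.
Proof. by rewrite sum1_size size_mset. Qed.

Lemma psize_sum (lam : parts) : psize lam = (\sum_(p <- enum_mset lam) p.1)%N.
Proof.
by rewrite (sum_mset lam xpredT (fun p => p.1)); apply: eq_bigr => p _; rewrite mulnC.
Qed.

Lemma big_msetD (A B : parts) (F : nat * nat -> nat) :
  (\sum_(p <- enum_mset (A `+` B)%mset) F p =
   \sum_(p <- enum_mset A) F p + \sum_(p <- enum_mset B) F p)%N.
Proof.
rewrite -big_cat; apply: perm_big; apply/allP => x _ /=.
by rewrite count_cat !count_mem_mset msetDE.
Qed.

Lemma plengthD (A B : parts) : plength (A `+` B)%mset = (plength A + plength B)%N.
Proof. by rewrite !plength_sum big_msetD. Qed.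

Lemma psizeD (A B : parts) : psize (A `+` B)%mset = (psize A + psize B)%N.
Proof. by rewrite !psize_sum big_msetD. Qed.

Lemma plength_raise mu : plength (raise mu) = plength mu.
Proof. by rewrite !plength_sum (perm_big _ (perm_eq_seq_mset _)) big_map. Qed.

Lemma psize_raise mu : psize (raise mu) = (psize mu + plength mu)%N.
Proof.
rewrite !psize_sum plength_sum (perm_big _ (perm_eq_seq_mset _)) big_map -big_split.
by apply: eq_bigr => p _; rewrite /= addn1.
Qed.

(** * Coefficients of generating series *)

(** The union of [T] and [raise mu] has length s + l(mu) and size s + |mu| + l(mu). Length l and
    size N thus mean l(mu) = l - s and |mu| = N - l; outside the guard no such [mu] exists. The
    colour bound on [B] gives finiteness. *)
Lemma generating_series_raise (A B : set parts) (m : nat) (T : parts) (s l N : nat) :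
  (forall mu, B mu -> coloured_partition m mu) ->
  plength T = s -> psize T = s ->
  (forall lam, A lam <-> exists2 mu, B mu & lam = (T `+` raise mu)%mset) ->
  generating_series A l N =
  if (s <= l <= N)%N then generating_series B (l - s)%N (N - l)%N else 0.
Proof.
move=> Bm lT sT AB; rewrite /generating_series; case: ifPn => slN; last first.
  rewrite (_ : (fun lam => _) = set0) ?fset_set0 ?cardfs0 //.
  apply/seteqP; split=> // lam [/AB[mu Bmu ->]] + sl.
  move: sl; rewrite plengthD psizeD plength_raise psize_raise lT sT; lia.
have inj : injective (fun mu => T `+` raise mu)%mset.
  by move=> x y /(congr1 (fun M => M `\` T)%mset); rewrite !msetDKB => /raise_inj.
congr Posz; set SA := mkset _; set SB := mkset _.
have -> : SA = ((fun mu => T `+` raise mu)%mset @` SB)%classic.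
  apply/seteqP; split=> lam.
    move=> [/AB[mu Bmu ->]].
    rewrite plengthD psizeD plength_raise psize_raise lT sT => h1 h2.
    by exists mu => //; split=> //; lia.
  move=> [mu [Bmu h1 h2] <-]; split; first by apply/AB; exists mu.
    rewrite plengthD plength_raise; lia.
  rewrite psizeD psize_raise; lia.
rewrite fset_set_image ?card_imfset //.
apply: sub_finite_set (finite_psize m (N - l)) => mu [Bmu _ sz]; split=> //.
exact: Bm.
Qed.

(** The exponent of q left for F is (N - s) - (l - s) = N - l, so the result has the shape of
    [generating_series_raise]. *)
Lemma series_mul_monomial_zq (F : series) (s l N : nat) :
  series_mul (series_monomial s s) (series_zq F) l N =
  if (s <= l <= N)%N then F (l - s)%N (N - l)%N else 0.
Proof.
rewrite /series_mul /series_monomial /series_zq.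
have [sl|sl] := leqP s l; last first.
  rewrite big1 //= => i _; rewrite big1 // => j _.
  by rewrite (_ : (i == s :> nat) = false) ?mul0r //; have := ltn_ord i; lia.
have [sN|sN] := leqP s N; last first.
  rewrite ifF; last by lia.
  rewrite big1 //= => i _; rewrite big1 // => j _.
  by rewrite (_ : (j == s :> nat) = false) ?andbF ?mul0r //; have := ltn_ord j; lia.
rewrite (bigD1 (inord s)) //= [X in _ + X]big1 ?addr0; last first.
  move=> i /eqP ni; rewrite big1 // => j _.
  rewrite (_ : (i == s :> nat) = false) ?mul0r //.
  by apply/eqP => e; apply: ni; apply: val_inj; rewrite /= inordK ?ltnS.
rewrite (bigD1 (inord s)) //= [X in _ + X]big1 ?addr0; last first.
  move=> i /eqP ni.
  rewrite (_ : (i == s :> nat) = false) ?andbF ?mul0r //.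
  by apply/eqP => e; apply: ni; apply: val_inj; rewrite /= inordK ?ltnS.
rewrite !inordK ?ltnS // eqxx mul1r.
have -> : (l - s <= N - s)%N = (l <= N)%N by lia.
by case: ifP => // lN; congr F; lia.
Qed.

(** Each partition has exactly one pair of multiplicities at x and y, and the bounds put this pair
    in the range of summation. *)
Lemma generating_series_split (A : set parts) (m a b : nat) (x y : nat * nat) l N :
  (forall lam, A lam -> coloured_partition m lam) ->
  (forall lam, A lam -> (lam x <= a)%N /\ (lam y <= b)%N) ->
  generating_series A l N =
  \sum_(0 <= i < a.+1) \sum_(0 <= j < b.+1)
    generating_series [set lam | [/\ A lam, lam x = i & lam y = j]]%classic l N.
Proof.
move=> Am Aab; rewrite /generating_series.
set SA := mkset _.
have finA : finite_set SA.
  by apply: sub_finite_set (finite_psize m N) => mu [/Am Bmu _ sz]; split.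
(* Each class is counted by an indicator over the one finite set [SA], so that the sums can be
   exchanged. *)
have cE i j : #|` fset_set [set lam | [/\ [/\ A lam, lam x = i & lam y = j],
     plength lam = l & psize lam = N]]%classic| =
   (\sum_(lam <- fset_set SA) ((lam x == i) && (lam y == j)))%N.
  rewrite -big_mkcond /= sum1_count -size_filter.
  apply: (@perm_size _ (enum_fset _)); apply: uniq_perm => //; first exact: filter_uniq.
  move=> lam; rewrite mem_filter in_fset_set; last first.
    by apply: sub_finite_set finA => mu [[? _ _] ? ?].
  rewrite in_fset_set //; apply/idP/idP.
    by move=> /set_mem [[? /eqP -> /eqP ->] ? ?]; apply/mem_set.
  by move=> /andP[/andP[/eqP ? /eqP ?] /set_mem [? ? ?]]; apply/mem_set.
under eq_bigr => i _ do under eq_bigr => j _ do rewrite cE -[Posz _]natz.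
under eq_bigr => i _ do rewrite -natr_sum.
rewrite -natr_sum natz; congr Posz.
under eq_bigr => i _ do rewrite exchange_big /=.
rewrite exchange_big /= -sum1_size; apply: eq_big_seq => lam.
rewrite in_fset_set // => /set_mem [/Aab [la lb] _ _].
have one c z : (z <= c)%N -> (\sum_(0 <= i < c.+1) (z == i) = 1)%N.
  move=> zc; rewrite (bigD1_seq z) ?iota_uniq ?mem_index_iota //= eqxx.
  by rewrite big1 // => i; rewrite eq_sym => /negPf ->.
under eq_bigr => i _ do under eq_bigr => j _ do rewrite -mulnb.
under eq_bigr => i _ do rewrite -big_distrr /= one // muln1.
by rewrite one.
Qed.

(** * Coefficients and levels of weights *)

Lemma wcoefD n (k1 k2 : weight n) c : wcoef (k1 + k2) c = (wcoef k1 c + wcoef k2 c)%N.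
Proof. by rewrite /wcoef ffunE. Qed.

Lemma wcoefMn n (k : weight n) a c : wcoef (k *+ a) c = (wcoef k c * a)%N.
Proof.
elim: a => [|a IH]; first by rewrite mulr0n /wcoef ffunE muln0.
by rewrite mulrS wcoefD IH mulnS.
Qed.

Lemma wcoefL n d c : (c <= n)%N -> wcoef (Lambda d : weight n) c = (c == d).
Proof. by move=> cn; rewrite /wcoef ffunE inordK ?ltnS. Qed.

Lemma levelD n (k1 k2 : weight n) : level (k1 + k2) = (level k1 + level k2)%N.
Proof. by rewrite /level -big_split; apply: eq_bigr => c _; rewrite ffunE. Qed.

Lemma levelMn n (k : weight n) a : level (k *+ a) = (level k * a)%N.
Proof.
elim: a => [|a IH]; first by rewrite mulr0n /level big1 ?muln0 // => c _; rewrite ffunE.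
by rewrite mulrS levelD IH mulnS.
Qed.

Lemma levelL n d : (d <= n)%N -> level (Lambda d : weight n) = 1%N.
Proof.
move=> dn; rewrite /level (bigD1 (inord d)) //= ffunE inordK ?ltnS // eqxx.
rewrite big1 // => c /eqP cd; rewrite ffunE; case: eqP => // e; case: cd.
by apply: val_inj; rewrite /= inordK ?ltnS.
Qed.

(** Spreads a number over the colours, so that a bound on a path sum can be checked colour by
    colour. *)
Lemma sum_delta M c v : (0 < c <= M)%N -> (\sum_(1 <= r < M.+1) v * (r == c) = v)%N.
Proof.
move=> cM; rewrite -big_distrr /= -[RHS]muln1; congr muln.
rewrite (bigD1_seq c) ?iota_uniq //=; last by rewrite mem_index_iota ltnS.
by rewrite eqxx big1 // => i /negPf ->.
Qed.

(** * The weights of the two identities and their boundary frequencies *)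

Definition weightC n a b : weight n := Lambda 0 *+ a + Lambda n *+ b.
(** The type D weight of the first identity; with i' = j' = 0 it is that of the second. *)
Definition weightD n i i' j' j : weight n.+1 :=
  Lambda 0 *+ i + Lambda 1 *+ i' + Lambda n *+ j' + Lambda n.+1 *+ j.

Lemma level_weightC n a b : level (weightC n a b) = (a + b)%N.
Proof. by rewrite levelD !levelMn !levelL // !mul1n. Qed.

Lemma level_weightD n i i' j' j : level (weightD n i i' j' j) = (i + i' + j' + j)%N.
Proof. by rewrite !levelD !levelMn !levelL // !mul1n. Qed.

(** For odd c, [c./2] is 0 exactly when c = 1 and n exactly when c = 2n+1. For n = 0 both terms
    count. *)
Lemma freqC_m1 n a b lam c : odd c -> (c <= 2 * n + 1)%N ->
  freqC (weightC n a b) lam c (Negz 0) = (a * (c == 1) + b * (c == 2 * n + 1))%N.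
Proof.
by move=> oc cn; rewrite /= oc wcoefD !wcoefMn !wcoefL; lia.
Qed.

(* For [n = 0] the third symbol of [weightD] is Lambda_0, which would add to f_0^(1). *)
Lemma freqD_0 n i i' j' j lam c : (0 < n)%N || (i' + j' == 0)%N ->
  freqD (weightD n i i' j' j) lam c 0 = (i * (c == 1) + j * (c == 2 * n + 1))%N.
Proof.
by move=> n0; rewrite /= !wcoefD !wcoefMn !wcoefL; lia.
Qed.

Lemma freqD_m1 n i i' j' j lam c : ~~ odd c -> (0 < c <= 2 * n + 1)%N ->
  freqD (weightD n i i' j' j) lam c (Negz 0) = (i' * (c == 2) + j' * (c == 2 * n))%N.
Proof.
by move=> oc cn; rewrite /= (negPf oc) !wcoefD !wcoefMn !wcoefL; lia.
Qed.

(** * Elementary facts on sums, path indices and coloured partitions *)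

Lemma leq_sum_range m n (F G : nat -> nat) :
  (forall r, (m <= r < n)%N -> (F r <= G r)%N) ->
  (\sum_(m <= r < n) F r <= \sum_(m <= r < n) G r)%N.
Proof.
move=> FG; rewrite big_nat_cond [X in (_ <= X)%N]big_nat_cond.
by apply: leq_sum => r; rewrite andbT => /FG.
Qed.

Lemma int_shift (s : nat) : Posz s + 1 = s.+1. Proof. lia. Qed.

(** The cases follow the constructors of [int], so that [freqC] and [freqD] compute in each of
    them. *)
Lemma int_casesP (x : int) : -1 <= x -> [\/ x = Negz 0, x = 0 | exists s, x = Posz s.+1].
Proof.
case: x => [[|s]|[|s]] h.
- by constructor 2.
- by constructor 3; exists s.
- by constructor 1.
- by exfalso; lia.
Qed.

Lemma coloured0 m (lam : parts) c : coloured_partition m lam -> lam (0%N, c) = 0%N.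
Proof.
move=> cl; apply/eqP; rewrite mset_eq0; apply/negP => /cl[]; by rewrite ltnn.
Qed.

Lemma coloured_lower m (lam : parts) :
  coloured_partition m lam -> coloured_partition m (lower lam).
Proof.
by move=> cl [[|s] c]; rewrite in_mset ?lower0E // lowerSE -in_mset => /cl[_ /=].
Qed.

(** * Second identity: type D partitions as shifted type C partitions *)

(** Rewrites the number of colours 2(n+1) - 1 as the 2n+1 of type C. *)
Lemma mem_partitions_D n (k : weight n.+1) lam : partitions_D k lam <->
  [/\ coloured_partition (2 * n + 1) lam,
      forall p, p \in lam -> odd p.1 = ~~ odd p.2 &
      forall idx, path_indices false (2 * n + 1) idx ->
        (\sum_(1 <= r < (2 * n + 1).+1) freqD k lam r (idx r) <= level k)%N].
Proof.
rewrite /partitions_D /=.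
by have -> : (2 * n.+1 - 1 = 2 * n + 1)%N by lia.
Qed.

Lemma freqC_raise n a b m mu r x : coloured_partition m mu ->
  (0 < r <= 2 * n + 1)%N -> -1 <= x -> (2 %| x + r%:Z)%Z ->
  freqC (weightC n a b) mu r x = freqD (weightD n a 0 0 b) (raise mu) r (x + 1).
Proof.
move=> cmu rn x1 xr; have := xr; case: (int_casesP x1) => [->|->|[s ->]] {xr} xr.
- rewrite freqC_m1; [|lia|lia].
  have -> : Negz 0 + 1 = 0 by lia.
  by rewrite freqD_0 // orbT.
- by rewrite int_shift /= raiseSE (coloured0 _ cmu).
- by rewrite int_shift /= raiseSE.
Qed.

(** Shifting down would send the index -1 to -2. The absolute value sends it to 0 instead, where the
    frequency is also 0; since -1 has only 0 as a neighbour on a path, adjacency survives. *)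
Lemma freqD_raise n a b m mu r x : coloured_partition m mu ->
  (0 < r <= 2 * n + 1)%N -> -1 <= x -> (2 %| x + r%:Z)%Z = false ->
  freqD (weightD n a 0 0 b) (raise mu) r x = freqC (weightC n a b) mu r (`|x| - 1).
Proof.
move=> cmu rn x1 xr; case: (ltP x 0) => x0.
  have -> : x = Negz 0 by lia.
  rewrite freqD_m1; [|lia|lia].
  have -> : `|Negz 0| - 1 = 0 :> int by lia.
  by rewrite /= !mul0n.
rewrite (@freqC_raise _ _ _ m) //; [|lia|lia].
by congr freqD; lia.
Qed.

Lemma mem_partitions_D_raise n a b lam :
  partitions_D (weightD n a 0 0 b) lam <->
  exists2 mu, partitions_C (weightC n a b) mu & lam = raise mu.
Proof.
rewrite mem_partitions_D level_weightD; split; last first.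
  move=> [mu [cmu omu pmu] ->]; split.
  - move=> [[|s] c]; rewrite in_mset ?raise0E // raiseSE -in_mset => /cmu /= [? ?].
    by split.
  - move=> [[|s] c]; rewrite in_mset ?raise0E // raiseSE -in_mset => /omu /= ->.
    by [].
  - move=> idx [ge par adj]; rewrite !addn0 -(level_weightC n a b).
    apply: leq_trans (pmu (fun c => `|idx c| - 1) _).
      apply: leq_sum_range => r rn; rewrite (freqD_raise _ _ cmu) //; last exact: par.
      by apply: ge; lia.
    split=> r rn; first by lia.
      by have := par r; have := ge r; lia.
    by have := adj r rn; have := par r; have := ge r; have := ge r.+1; lia.
move=> [cl ol pl].
have l1 c : lam (1%N, c) = 0%N.
  apply/eqP; rewrite mset_eq0; apply/negP => lc.
  have [_ cn] := cl _ lc; have /= oc := ol _ lc.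
  (* A part of size 1 has even colour in type D. This path meets f_1 in every even colour, while f_0
     in the extreme colours already uses up the level a + b. *)
  pose idx r : int := if odd r then 0 else 1.
  have P : path_indices false (2 * n + 1) idx.
    by split=> r rn; rewrite /idx /=; case: (boolP (odd r)) => //= od; lia.
  have lc0 : (0 < lam (1%N, c))%N by rewrite -in_mset.
  suff : (a + lam (1%N, c) + b <= \sum_(1 <= r < (2 * n + 1).+1)
     freqD (weightD n a 0 0 b) lam r (idx r))%N.
    by have := pl _ P; lia.
  have e1 : (0 < 1 <= 2 * n + 1)%N by lia.
  have e2 : (0 < 2 * n + 1 <= 2 * n + 1)%N by lia.
  (* The three summands are placed at the colours 1, c and 2n+1. *)
  rewrite -[X in (X + _ + _)%N](sum_delta _ e1) -[X in (_ + X + _)%N](sum_delta _ cn).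
  rewrite -[X in (_ + _ + X)%N](sum_delta _ e2) -!big_split /=.
  apply: leq_sum_range => r rn; rewrite /idx; case: ifP => or.
    rewrite freqD_0 ?orbT //.
    have -> : ((r == c) = false)%N by apply/eqP => e; rewrite -e or in oc.
    by rewrite muln0 addn0.
  have -> : ((r == 1) = false)%N by lia.
  have -> : ((r == 2 * n + 1) = false)%N by lia.
  by case: eqP => [->|]; rewrite !muln0 ?muln1 ?add0n ?addn0.
have el : lam = raise (lower lam).
  apply/msetP => -[[|[|s]] c]; first by rewrite raise0E (coloured0 _ cl).
    by rewrite raiseSE lower0E l1.
  by rewrite raiseSE lowerSE.
have cmu := coloured_lower cl.
exists (lower lam); last exact: el.
split=> //.
  move=> [[|s] c]; rewrite in_mset ?lower0E // lowerSE -in_mset => /ol /=.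
  by move/negb_inj.
move=> idx [ge par adj]; rewrite level_weightC.
have -> : (a + b = a + 0 + 0 + b)%N by lia.
apply: leq_trans (pl (fun c => idx c + 1) _).
  apply: leq_sum_range => r rn; rewrite (freqC_raise _ _ cmu) // -?el //.
    by apply: ge; lia.
  exact: par.
split=> r rn.
- by have := ge r rn; lia.
- by have := par r rn; lia.
- by have := adj r rn; lia.
Qed.

(** * First identity: splitting off the parts of size 1 *)

(** The removed parts, which account for the factor (zq)^(i+j). *)
Definition ones n i j : parts :=
  (msetn i (1%N, 1%N) `+` msetn j (1%N, (2 * n + 1)%N))%mset.

Lemma ones1E n i j c :
  ones n i j (1%N, c) = (i * (c == 1) + j * (c == 2 * n + 1))%N.
Proof.
by rewrite msetDE !msetnE !xpair_eqE /=; do 2![case: eqP => _]; rewrite ?muln1 ?muln0.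
Qed.

Lemma ones_neq1 n i j s c : s != 1%N -> ones n i j (s, c) = 0%N.
Proof. by move=> /negPf s1; rewrite msetDE !msetnE !xpair_eqE s1. Qed.

Lemma plength_ones n i j : plength (ones n i j) = (i + j)%N.
Proof. by rewrite plengthD !plength_sum !enum_msetn !sum1_size !size_nseq. Qed.

Lemma psize_ones n i j : psize (ones n i j) = (i + j)%N.
Proof.
by rewrite psizeD !psize_sum !enum_msetn !big_nseq !iter_addn /= !mul1n !addn0.
Qed.

Lemma lift0E n i j mu c : (ones n i j `+` raise mu)%mset (0%N, c) = 0%N.
Proof. by rewrite msetDE ones_neq1 // raise0E. Qed.

Lemma lift1E n i j m mu c : coloured_partition m mu ->
  (ones n i j `+` raise mu)%mset (1%N, c) = (i * (c == 1) + j * (c == 2 * n + 1))%N.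
Proof. by move=> cmu; rewrite msetDE ones1E raiseSE (coloured0 _ cmu) addn0. Qed.

Lemma liftSSE n i j mu s c : (ones n i j `+` raise mu)%mset (s.+2, c) = mu (s.+1, c).
Proof. by rewrite msetDE ones_neq1 // raiseSE. Qed.

(** Boundary values and transfers occur only at the colours 1, 2, 2n and 2n+1. Once r is compared
    with these, all indicators are constants and the inequality is linear. *)
Ltac cases_r al be r n :=
  case: al; case: be; case: (r =P 1%N) => ?; case: (r =P 2%N) => ?;
  case: (r =P (2 * n)%N) => ?; case: (r =P (2 * n + 1)%N) => ?;
  rewrite ?muln0 ?muln1 ?addn0 ?add0n; lia.

(* A path of type D through f_0^(1) = i and f_{-1}^(2) = a - i corresponds to one
   of type C through f_{-1}^(1) = a and f_0^(2) = 0, and likewise for the colours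
   2n+1 and 2n. The terms with [al] and [be] move the amounts a - i and b - j to
   the neighbouring colour and cancel when the inequality is summed over [r]. *)
Lemma freqC_lift_le n a b i j m mu (al be : bool) r x :
  (0 < n)%N -> (i <= a)%N -> (j <= b)%N -> coloured_partition m mu ->
  (0 < r <= 2 * n + 1)%N -> -1 <= x -> (2 %| x + r%:Z)%Z ->
  (r = 1%N -> x = -1 -> al) -> (r = 2%N -> al = (x == 0)) ->
  (r = (2 * n)%N -> be = (x == 0)) -> (r = (2 * n + 1)%N -> x = -1 -> be) ->
  (freqC (weightC n a b) (ones n i j `+` raise mu)%mset r x
     + (a - i) * al * (r == 2) + (b - j) * be * (r == 2 * n) <=
   freqD (weightD n i (a - i) (b - j) j) mu r (`|x| - 1)
     + (a - i) * al * (r == 1) + (b - j) * be * (r == 2 * n + 1))%N.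
Proof.
move=> n0 ia jb cmu rn x1; case: (int_casesP x1) => [->|->|[s ->]] xr h1 h2 h3 h4.
- rewrite freqC_m1; [|lia|lia].
  have -> : `|Negz 0| - 1 = 0 :> int by lia.
  rewrite freqD_0 ?n0 //; move: h1 h2 h3 h4; cases_r al be r n.
- have -> : `|0 : int| - 1 = Negz 0 by [].
  rewrite freqD_m1 /=; [|lia|lia]; move: h1 h2 h3 h4; cases_r al be r n.
- have -> : `|Posz s.+1| - 1 = s by lia.
  case: s xr h1 h2 h3 h4 => [|s] xr h1 h2 h3 h4.
    rewrite /freqC (lift1E _ _ _ _ cmu) freqD_0 ?n0 //; move: h1 h2 h3 h4; cases_r al be r n.
  rewrite /= liftSSE; move: (mu _) h1 h2 h3 h4 => v; cases_r al be r n.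
Qed.

(** The reverse comparison. If [al] holds, the type D path has f_0^(1) = i and f_{-1}^(2) = a - i.
    Colour 2 then moves to f_0^(2) = 0, and sending colour 1 to f_{-1}^(1) = a rather than to
    f_1^(1) = i makes up for the loss. The same holds for [be] at the colours 2n+1 and 2n. *)
Lemma freqD_lift_le n a b i j m mu (al be : bool) r x :
  (0 < n)%N -> (i <= a)%N -> (j <= b)%N -> coloured_partition m mu ->
  (0 < r <= 2 * n + 1)%N -> -1 <= x -> (2 %| x + r%:Z)%Z = false ->
  (r = 1%N -> al -> x = 0) -> (r = 2%N -> al = (x == -1)) ->
  (r = (2 * n)%N -> be = (x == -1)) -> (r = (2 * n + 1)%N -> be -> x = 0) ->
  (freqD (weightD n i (a - i) (b - j) j) mu r x
     + (a - i) * al * (r == 1) + (b - j) * be * (r == 2 * n + 1) <=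
   freqC (weightC n a b) (ones n i j `+` raise mu)%mset r
     (if (al && (r == 1)%N) || (be && (r == 2 * n + 1)%N) then -1 else x + 1)%R
     + (a - i) * al * (r == 2) + (b - j) * be * (r == 2 * n))%N.
Proof.
move=> n0 ia jb cmu rn x1; case: (int_casesP x1) => [->|->|[s ->]] xr h1 h2 h3 h4.
- rewrite freqD_m1; [|lia|lia].
  rewrite ifF; last by lia.
  have -> : Negz 0 + 1 = 0 by lia.
  rewrite /=; move: h1 h2 h3 h4; cases_r al be r n.
- rewrite freqD_0 ?n0 //; case: ifP => h.
    have -> : -1 = Negz 0 by lia.
    rewrite freqC_m1; [move: h h1 h2 h3 h4; cases_r al be r n|lia|lia].
  rewrite int_shift /freqC (lift1E _ _ _ _ cmu); move: h h1 h2 h3 h4; cases_r al be r n.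
- rewrite ifF; last by lia.
  rewrite int_shift /= liftSSE; move: h1 h2 h3 h4; cases_r al be r n.
Qed.

(** By parity c is odd. The path takes f_1 in colour c, f_{-1} in the other odd colours and f_0 in
    the even ones. *)
Lemma partitions_C_ones n a b lam c : partitions_C (weightC n a b) lam ->
  (1%N, c) \in lam ->
  (lam (1%N, c) + a * (c != 1) + b * (c != 2 * n + 1) <= a + b)%N.
Proof.
move=> [cl ol pl] lc; have [_ /= cn] := cl _ lc; have /= oc := ol _ lc.
pose idx r : int := if odd r then (if (r == c)%N then 1 else -1) else 0.
have P : path_indices true (2 * n + 1) idx.
  split=> r rn; rewrite /idx /=; case: (boolP (odd r)) => //= od; do ?case: eqP; lia.
have := pl _ P; rewrite level_weightC; apply: leq_trans.
have e1 : (0 < 1 <= 2 * n + 1)%N by lia.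
have e2 : (0 < 2 * n + 1 <= 2 * n + 1)%N by lia.
rewrite -[X in (X + _ + _)%N](sum_delta _ cn) -[X in (_ + X + _)%N](sum_delta _ e1).
rewrite -[X in (_ + _ + X)%N](sum_delta _ e2) -!big_split /=.
apply: leq_sum_range => r rn; rewrite /idx; case: (boolP (odd r)) => od; last first.
  have -> : (r == c) = false by apply/eqP => e; move: od; rewrite e -oc.
  have -> : (r == 1%N) = false by lia.
  have -> : (r == 2 * n + 1)%N = false by lia.
  by rewrite !muln0.
case: eqP => [->|rc].
  rewrite /=; move: (lam _) => v; lia.
by rewrite freqC_m1 //; lia.
Qed.

Lemma partitions_C_ones0 n a b lam c : partitions_C (weightC n a b) lam ->
  c != 1%N -> c != (2 * n + 1)%N -> lam (1%N, c) = 0%N.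
Proof.
move=> Cl c1 cn; apply/eqP; rewrite mset_eq0; apply/negP => lc.
have := partitions_C_ones Cl lc; rewrite c1 cn !muln1.
have : (0 < lam (1%N, c))%N by rewrite -in_mset.
by move: (lam _) => v; lia.
Qed.

(** For n >= 1 the extreme colours differ, so in [partitions_C_ones] the opposite one uses up b,
    respectively a, of the level. *)
Lemma partitions_C_ones_le n a b lam : (0 < n)%N -> partitions_C (weightC n a b) lam ->
  (lam (1%N, 1%N) <= a)%N /\ (lam (1%N, (2 * n + 1)%N) <= b)%N.
Proof.
move=> n0 Cl.
have h c : (lam (1%N, c) = 0%N) \/
  (lam (1%N, c) + a * (c != 1) + b * (c != 2 * n + 1) <= a + b)%N.
  have [lc|lc] := boolP ((1%N, c) \in lam); first by right; apply: partitions_C_ones.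
  by left; apply/eqP; rewrite mset_eq0.
split; [move: (h 1%N)|move: (h (2 * n + 1)%N)]; move: (lam _) => v; rewrite ?eqxx; lia.
Qed.

(** Moving v and w between colours adds v + w to both totals, so the colourwise inequalities need to
    hold only up to such transfers. *)
Lemma leq_sum_transfer M (F G : nat -> nat) v w c d c' d' :
  (0 < c <= M)%N -> (0 < d <= M)%N -> (0 < c' <= M)%N -> (0 < d' <= M)%N ->
  (forall r, (0 < r <= M)%N ->
    (F r + v * (r == c) + w * (r == d) <= G r + v * (r == c') + w * (r == d'))%N) ->
  (\sum_(1 <= r < M.+1) F r <= \sum_(1 <= r < M.+1) G r)%N.
Proof.
move=> cM dM c'M d'M FG; rewrite -(leq_add2r v) -(leq_add2r w).
rewrite -[X in (_ + X + _ <= _)%N](sum_delta v cM) -[X in (_ + X <= _)%N](sum_delta w dM).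
rewrite -[X in (_ <= _ + X + _)%N](sum_delta v c'M) -[X in (_ <= _ + X)%N](sum_delta w d'M).
by rewrite -!big_split /=; apply: leq_sum_range.
Qed.

Lemma mem_partitions_C_ones n a b i j lam : (0 < n)%N -> (i <= a)%N -> (j <= b)%N ->
  [/\ partitions_C (weightC n a b) lam, lam (1%N, 1%N) = i &
      lam (1%N, (2 * n + 1)%N) = j] <->
  exists2 mu, partitions_D (weightD n i (a - i) (b - j) j) mu &
    lam = (ones n i j `+` raise mu)%mset.
Proof.
move=> n0 ia jb.
have e1 : (0 < 1 <= 2 * n + 1)%N by lia.
have e2 : (0 < 2 <= 2 * n + 1)%N by lia.
have e3 : (0 < 2 * n <= 2 * n + 1)%N by lia.
have e4 : (0 < 2 * n + 1 <= 2 * n + 1)%N by lia.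
split.
  move=> [Cl l1 l2]; have [cl ol pl] := Cl.
  (* [lower] loses exactly the parts of size 1, which by [partitions_C_ones0] all have an extreme
     colour. *)
  have el : lam = (ones n i j `+` raise (lower lam))%mset.
    apply/msetP => -[[|[|s]] c]; rewrite msetDE.
    - by rewrite ones_neq1 // raise0E (coloured0 _ cl).
    - rewrite ones1E raiseSE lower0E addn0.
      have [->|c1] := eqVneq c 1%N.
        by rewrite l1 (_ : (_ == 2 * n + 1)%N = false) ?muln1 ?muln0 ?addn0 //; lia.
      have [->|c2] := eqVneq c (2 * n + 1)%N; first by rewrite l2 muln1 muln0.
      by rewrite (partitions_C_ones0 Cl c1 c2) !muln0.
    - by rewrite ones_neq1 // raiseSE lowerSE.
  exists (lower lam); last exact: el.
  apply/mem_partitions_D.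
  have cmu := coloured_lower cl.
  split=> //.
    move=> [[|s] c]; rewrite in_mset ?lower0E // lowerSE -in_mset => /ol /= <-.
    by rewrite negbK.
  move=> idx [ge par adj].
  pose al := idx 2%N == -1; pose be := idx (2 * n)%N == -1.
  (* Replacing 1 by -1 at an extreme colour keeps a path, since the neighbouring colour then has
     index 0. *)
  have P : path_indices true (2 * n + 1) (fun r =>
      if (al && (r == 1)%N) || (be && (r == 2 * n + 1)%N) then -1 else idx r + 1).
    split=> r rn.
    - by case: ifP => _ //; have := ge r rn; lia.
    - by have := par r rn; case: ifP; lia.
    have a1 : al -> idx 2%N = -1 by move/eqP.
    have b1 : be -> idx (2 * n)%N = -1 by move/eqP.
    case: ifP => h.
      have [r1|rn1] : (al /\ r = 1%N) \/ (r = 2 * n + 1)%N by lia.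
        by case: r1 => /a1 x1 ->; rewrite x1 ifF //; lia.
      by exfalso; lia.
    case: ifP => h'; last by have := adj r rn; lia.
    have [/b1 x1 ->] : be /\ (r = 2 * n)%N by lia.
    by rewrite x1; lia.
  have := pl _ P; rewrite level_weightD level_weightC.
  have -> : (i + (a - i) + (b - j) + j = a + b)%N by lia.
  apply: leq_trans; apply: (leq_sum_transfer e1 e4 e2 e3) => r rn; rewrite [X in freqC _ X]el.
  apply: (@freqD_lift_le _ _ _ _ _ _ _ al be _ _ n0 ia jb cmu) => //.
  + by apply: ge.
  + by apply: par.
  (* Next to an index -1 only the index 0 is allowed. *)
  + move=> -> /eqP x1; have := adj 1%N; have := ge 1%N e1; rewrite x1; lia.
  + by move=> ->.
  + by move=> ->.
  + move=> -> /eqP x1; have := adj (2 * n)%N; have := ge _ e4; rewrite -(addn1 (2 * n)) x1; lia.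
move=> [mu /mem_partitions_D[cmu omu pmu] ->]; split; first split.
- move=> [[|[|s]] c]; rewrite in_mset ?lift0E // ?(lift1E _ _ _ _ cmu) ?liftSSE.
    by move=> h /=; lia.
  by rewrite -in_mset => /cmu[].
- move=> [[|[|s]] c]; rewrite in_mset ?lift0E // ?(lift1E _ _ _ _ cmu) ?liftSSE.
    by move=> h /=; lia.
  by rewrite -in_mset => /omu /= ->; rewrite negbK.
- move=> idx [ge par adj].
  have P : path_indices false (2 * n + 1) (fun r => `|idx r| - 1).
    split=> r rn; first lia.
      by have := par r; have := ge r; lia.
    by have := adj r rn; have := par r; have := ge r; have := ge r.+1; lia.
  have := pmu _ P; rewrite level_weightD level_weightC.
  have -> : (i + (a - i) + (b - j) + j = a + b)%N by lia.
  apply: leq_trans.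
  apply: (leq_sum_transfer e2 e3 e1 e4) => r rn.
  (* The transfers occur exactly when the image path has index -1 in colour 2, respectively 2n. *)
  apply: (@freqC_lift_le _ _ _ _ _ _ _ (idx 2%N == 0) (idx (2 * n)%N == 0) _ _ n0 ia jb cmu) => //.
  + by apply: ge.
  + by apply: par.
  + move=> -> x1; have := adj 1%N; have := ge 2%N e2; rewrite x1; lia.
  + by move=> ->.
  + by move=> ->.
  + move=> -> x1; have := adj (2 * n)%N; have := ge (2 * n)%N e3; rewrite -(addn1 (2 * n)) x1; lia.
- rewrite (lift1E _ _ _ _ cmu) eqxx (_ : (_ == 2 * n + 1)%N = false); lia.
- rewrite (lift1E _ _ _ _ cmu) eqxx (_ : (_ == 1)%N = false); lia.
Qed.

(** * The identities of generating series *)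

Theorem proposition4p4 (a k n : nat) (hak : (a <= k)%N) :
  ((1 <= n)%N ->
     series_C (Lambda 0 *+ a + Lambda n *+ (k - a) : weight n) =
     \sum_(0 <= i < a.+1) \sum_(0 <= j < (k - a).+1)
       series_mul (series_monomial (i + j)%N (i + j)%N)
         (series_zq (series_D
           (Lambda 0 *+ i + Lambda 1 *+ (a - i)
            + Lambda n *+ (k - a - j) + Lambda n.+1 *+ j : weight n.+1))))
  /\
  series_D (Lambda 0 *+ a + Lambda n.+1 *+ (k - a) : weight n.+1) =
  series_zq (series_C (Lambda 0 *+ a + Lambda n *+ (k - a) : weight n)).
Proof.
split=> [n0|].
  apply/funext => l; apply/funext => N.
  rewrite !fct_sumE.
  rewrite /series_C (@generating_series_split _ (2 * n + 1) a (k - a)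
    (1%N, 1%N) (1%N, (2 * n + 1)%N)); first last.
  - by move=> lam; apply: partitions_C_ones_le.
  - by move=> lam [].
  apply: eq_big_nat => i ia; rewrite !fct_sumE; apply: eq_big_nat => j jb.
  rewrite series_mul_monomial_zq; apply: (@generating_series_raise _ _ (2 * n + 1) (ones n i j)).
  - by move=> mu /mem_partitions_D[].
  - exact: plength_ones.
  - exact: psize_ones.
  - by move=> lam; apply: mem_partitions_C_ones; rewrite // -ltnS.
have <- : weightD n a 0 0 (k - a) = Lambda 0 *+ a + Lambda n.+1 *+ (k - a).
  by rewrite /weightD !mulr0n !addr0.
apply/funext => l; apply/funext => N.
(* With no parts added and s = 0, the coefficient formula becomes that of [series_zq]. *)
rewrite /series_D (@generating_series_raise _ (partitions_C (weightC n a (k - a)))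
  (2 * n + 1) mset0 0) ?subn0 //.
- by move=> mu [].
- by rewrite plength_sum enum_mset0 big_nil.
- by rewrite psize_sum enum_mset0 big_nil.
- move=> lam; rewrite mem_partitions_D_raise.
  by split=> -[mu Cmu ->]; exists mu; rewrite ?mset0D.
Qed.
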